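(* Let $(K,<)$ be a nonarchimedean ordered field with natural valuation $v$, and let $f$ be a strong $T_1$-exponential on $(K,<)$. Let $w$ be a coarsening of $v$. Then $w$ is compatible with $f$ if and only if for every $a\in K$, $$va\in G_w \ \Longrightarrow\ vf(a)\in G_w .$$
   Context: Valuations are written additively, with $w0=\infty$; $R_w$ denotes the valuation ring of $w$, $I_w$ its valuation ideal, $wK$ its value group. The natural valuation $v$ of an ordered field $(K,<)$ sends a nonzero $a$ to its archimedean class, with $va<vb$ iff $|a|>n|b|$ for all $n\in\mathbb N$; so $R_v=\{a: |a|\le n \text{ for some } n\in\mathbb N\}$ and $I_v$ is the set of infinitesimals. $K$ is nonarchimedean iff $v$ is nontrivial. A coarsening of $v$ is a valuation $w$ of $K$ with $R_w\supseteq R_v$ (so $w=v$ and the trivial valuation are allowed); all of these have convex valuation ring. For such $w$ put $\mathcal U_w^{>0}=\{a\in K: wa=0,\ a>0\}$ and $G_w=\{va: a\in K,\ wa=0\}$, a convex subgroup of $vK$. $K^{>0}$ is the set of positive elements of $K$. An exponential $f$ on $(K,<)$ is an isomorphism of ordered groups from $(K,+,0,<)$ onto $(K^{>0},\cdot,1,<)$. A valuation $w$ (coarsening of $v$) and $f$ are compatible if $f(R_w)=\mathcal U_w^{>0}$ and $f(I_w)=1+I_w$. $f$ is a $T_1$-exponential if $v$ is compatible with $f$ and $v(f(a)-1-a)>va$ for all nonzero $a\in I_v$. $f$ is strong if for every $n\in\mathbb N$ and every $a\in K$: $a>n^2\Rightarrow f(a)>a^n$. *)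

(* Defs.v *)
From HB Require Import structures.
From mathcomp Require Import all_boot all_order all_algebra.
From mathcomp Require Import boolp classical_sets.

Set Implicit Arguments.
Unset Strict Implicit.
Unset Printing Implicit Defensive.
Import Order.TTheory GRing.Theory Num.Theory.

Local Open Scope quotient_scope.
Local Open Scope classical_set_scope.
Local Open Scope ring_scope.

(* [porderZmodType] alone imposes no compatibility between order and addition. *)
HB.mixin Record isOrderedAbGroup G of Num.POrderedZmodule G := {
  le_total_oag : total (<=%R : rel G);
  leD2l_oag : forall z x y : G, x <= y -> z + x <= z + y
}.

#[short(type="orderedAbGroupType")]
HB.structure Definition OrderedAbGroup :=
  { G of Num.POrderedZmodule G & isOrderedAbGroup G }.

(* [G] with a largest, additively absorbing element [infty] adjoined *)
Definition withInfty (G : Type) := option G.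
Definition fin {G : Type} (g : G) : withInfty G := Some g.
Definition infty {G : Type} : withInfty G := None.

Section WithInfty.
Variable G : orderedAbGroupType.
Implicit Types x y z : withInfty G.

HB.instance Definition _ := Choice.copy (withInfty G) (option G).

Definition infty_le x y : bool :=
  match x, y with
  | _, None => true
  | None, Some _ => false
  | Some a, Some b => a <= b
  end.

Definition infty_add x y : withInfty G :=
  match x, y with
  | Some a, Some b => Some (a + b)
  | _, _ => None
  end.

Lemma infty_le_anti : antisymmetric infty_le.
Proof. by case=> [a|] [b|] //= /le_anti ->. Qed.

Lemma infty_le_trans : transitive infty_le.
Proof. by case=> [a|] [b|] [c|] //=; apply: le_trans. Qed.

Lemma infty_le_total : total infty_le.
Proof. by case=> [a|] [b|] //=; apply: le_total_oag. Qed.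

HB.instance Definition _ := Order.isOrder.Build ring_display (withInfty G)
  (fun _ _ => erefl) (fun _ _ => erefl) (fun _ _ => erefl)
  infty_le_anti infty_le_trans infty_le_total.

Lemma infty_addA : associative infty_add.
Proof. by case=> [a|] [b|] [c|] //=; rewrite addrA. Qed.

Lemma infty_addC : commutative infty_add.
Proof. by case=> [a|] [b|] //=; rewrite addrC. Qed.

Lemma infty_add0 : left_id (fin (0 : G)) infty_add.
Proof. by case=> [a|] //=; rewrite add0r. Qed.

HB.instance Definition _ :=
  GRing.isNmodule.Build (withInfty G) infty_addA infty_addC infty_add0.

Lemma lex_infty x : x <= infty.
Proof. by case: x. Qed.

Lemma addr_infty x : x + infty = infty.
Proof. by case: x. Qed.

End WithInfty.

(* The value group is the set of finite values of [val_fun]; it may be a proper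
   subgroup of [G]. *)
Record valuation (K : fieldType) (G : orderedAbGroupType) := Valuation {
  val_fun :> K -> withInfty G;
  valuation_infty : forall a, val_fun a = infty <-> a = 0;
  valuationM : forall a b, val_fun (a * b) = val_fun a + val_fun b;
  valuationD : forall a b, Num.min (val_fun a) (val_fun b) <= val_fun (a + b)
}.

Section ArchClass.
Variable K : realFieldType.

(* The order is reversed: [arch_le a b] says that the class of [a] is at most
   the class of [b], i.e. that [b] is bounded by an integer multiple of [a]. *)
Definition arch_le (a b : K) : bool :=
  `[< exists n : nat, `|b| <= n%:R * `|a| >].

Lemma arch_leP a b :
  reflect (exists n : nat, `|b| <= n%:R * `|a|) (arch_le a b).
Proof. exact: asboolP. Qed.

Lemma arch_le_refl a : arch_le a a.
Proof. by apply/arch_leP; exists 1%N; rewrite mul1r. Qed.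

Lemma arch_le_trans : transitive arch_le.
Proof.
move=> b a c /arch_leP[n nP] /arch_leP[m mP]; apply/arch_leP.
exists (m * n)%N; apply: (le_trans mP).
by rewrite natrM -mulrA ler_wpM2l.
Qed.

Lemma arch_le_total : total arch_le.
Proof.
move=> a b; case: (leP `|a| `|b|) => [ab|/ltW ba]; apply/orP; [right|left];
  by apply/arch_leP; exists 1%N; rewrite mul1r.
Qed.

Lemma arch_leM a b c d : arch_le a b -> arch_le c d -> arch_le (a * c) (b * d).
Proof.
move=> /arch_leP[n nP] /arch_leP[m mP]; apply/arch_leP; exists (n * m)%N.
by rewrite !normrM natrM mulrACA ler_pM.
Qed.

Definition arch_equiv (a b : K) : bool := arch_le a b && arch_le b a.

(* [nonzero] and [archClass] present the value group of the natural valuation as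
   a quotient of the multiplicative group of [K], written additively. *)
Record nonzero := NonZero { nonzero_val :> K; nonzeroP : nonzero_val != 0 }.
HB.instance Definition _ := [isSub for nonzero_val].
HB.instance Definition _ := [Choice of nonzero by <:].

Definition nonzero_equiv (x y : nonzero) : bool := arch_equiv x y.

Lemma nonzero_equiv_refl : reflexive nonzero_equiv.
Proof. by move=> x; rewrite /nonzero_equiv /arch_equiv arch_le_refl. Qed.

Lemma nonzero_equiv_sym : symmetric nonzero_equiv.
Proof. by move=> x y; rewrite /nonzero_equiv /arch_equiv andbC. Qed.

Lemma nonzero_equiv_trans : transitive nonzero_equiv.
Proof.
move=> y x z /andP[xy yx] /andP[yz zy]; apply/andP.
by split; apply: (@arch_le_trans y).
Qed.

Canonical nonzero_equiv_rel := EquivRel nonzero_equiv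
  nonzero_equiv_refl nonzero_equiv_sym nonzero_equiv_trans.

Definition archClass := {eq_quot nonzero_equiv}.
HB.instance Definition _ := Choice.on archClass.

Definition archCls (x : nonzero) : archClass := \pi_archClass x.
Definition archRep (X : archClass) : nonzero := repr X.

Lemma archRepK X : archCls (archRep X) = X.
Proof. exact: reprK. Qed.

Lemma archClsP x y : archCls x = archCls y <-> arch_equiv x y.
Proof. by split=> [/eqmodP|xy] //; apply/eqmodP. Qed.

Lemma archClsK x : arch_equiv (archRep (archCls x)) x.
Proof. by apply/archClsP; rewrite archRepK. Qed.

Definition nonzero_mul (x y : nonzero) : nonzero :=
  NonZero (mulf_neq0 (nonzeroP x) (nonzeroP y)).
Definition nonzero_one : nonzero := NonZero (oner_neq0 K).
Lemma nonzero_inv_subproof (x : nonzero) : (x : K)^-1 != 0.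
Proof. by rewrite invr_eq0 nonzeroP. Qed.
Definition nonzero_inv (x : nonzero) : nonzero :=
  NonZero (nonzero_inv_subproof x).

Definition archClass_add (X Y : archClass) : archClass :=
  archCls (nonzero_mul (archRep X) (archRep Y)).
Definition archClass_opp (X : archClass) : archClass :=
  archCls (nonzero_inv (archRep X)).
Definition archClass_le (X Y : archClass) : bool :=
  arch_le (archRep X) (archRep Y).

Lemma archCls_mul x y :
  archClass_add (archCls x) (archCls y) = archCls (nonzero_mul x y).
Proof.
have /andP[x1 x2] := archClsK x; have /andP[y1 y2] := archClsK y.
by apply/archClsP/andP; split; apply: arch_leM.
Qed.

Lemma archCls_le x y : archClass_le (archCls x) (archCls y) = arch_le x y.
Proof.
have /andP[x1 x2] := archClsK x; have /andP[y1 y2] := archClsK y.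
rewrite /archClass_le; apply/idP/idP => [xy|xy].
  exact: (arch_le_trans x2 (arch_le_trans xy y1)).
exact: (arch_le_trans x1 (arch_le_trans xy y2)).
Qed.

Lemma archClass_addA : associative archClass_add.
Proof.
move=> X Y Z; rewrite -(archRepK X) -(archRepK Y) -(archRepK Z) !archCls_mul.
by congr archCls; apply: val_inj; rewrite /= mulrA.
Qed.

Lemma archClass_addC : commutative archClass_add.
Proof.
move=> X Y; rewrite -(archRepK X) -(archRepK Y) !archCls_mul.
by congr archCls; apply: val_inj; rewrite /= mulrC.
Qed.

Lemma archClass_add0 : left_id (archCls nonzero_one) archClass_add.
Proof.
move=> X; rewrite -(archRepK X) !archCls_mul.
by congr archCls; apply: val_inj; rewrite /= mul1r.
Qed.

Lemma archClass_addN :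
  left_inverse (archCls nonzero_one) archClass_opp archClass_add.
Proof.
move=> X; rewrite -{2}(archRepK X) archCls_mul.
by congr archCls; apply: val_inj; rewrite /= mulVf ?nonzeroP.
Qed.

HB.instance Definition _ := GRing.isZmodule.Build archClass
  archClass_addA archClass_addC archClass_add0 archClass_addN.

Lemma archClass_le_anti : antisymmetric archClass_le.
Proof. by move=> X Y XY; rewrite -(archRepK X) -(archRepK Y); apply/archClsP. Qed.

Lemma archClass_le_trans : transitive archClass_le.
Proof. by move=> Y X Z; apply: arch_le_trans. Qed.

Lemma archClass_le_total : total archClass_le.
Proof. by move=> X Y; apply: arch_le_total. Qed.

HB.instance Definition _ := Order.isOrder.Build ring_display archClass
  (fun _ _ => erefl) (fun _ _ => erefl) (fun _ _ => erefl)
  archClass_le_anti archClass_le_trans archClass_le_total.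

Lemma archClass_leD2l (Z X Y : archClass) : X <= Y -> Z + X <= Z + Y.
Proof.
rewrite -(archRepK X) -(archRepK Y) -(archRepK Z) => XY.
have {}XY : arch_le (archRep X) (archRep Y) by rewrite -archCls_le.
suff: archClass_le (archClass_add (archCls (archRep Z)) (archCls (archRep X)))
  (archClass_add (archCls (archRep Z)) (archCls (archRep Y))) by [].
by rewrite !archCls_mul archCls_le arch_leM ?arch_le_refl.
Qed.

HB.instance Definition _ := isOrderedAbGroup.Build archClass
  archClass_le_total archClass_leD2l.

Definition natural_fun (a : K) : withInfty archClass :=
  if insub a is Some x then fin (archCls x) else infty.

Lemma natural_funE (a : K) (a0 : a != 0) :
  natural_fun a = fin (archCls (NonZero a0)).
Proof. by rewrite /natural_fun (insubT (fun x => x != 0) a0). Qed.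

Lemma natural_fun0 : natural_fun 0 = infty.
Proof. by rewrite /natural_fun insubF ?eqxx. Qed.

Lemma natural_fun_le (a b : K) : (natural_fun a <= natural_fun b) = arch_le a b.
Proof.
have [->|b0] := eqVneq b 0.
  rewrite natural_fun0; have -> : arch_le a 0.
    by apply/arch_leP; exists 0%N; rewrite normr0 mul0r.
  exact: lex_infty.
have [->|a0] := eqVneq a 0; last first.
  rewrite (natural_funE a0) (natural_funE b0).
  exact: (archCls_le (NonZero a0) (NonZero b0)).
rewrite natural_fun0 (natural_funE b0); apply/idP/idP => [//|/arch_leP[n]].
by rewrite normr0 mulr0 normr_le0 (negPf b0).
Qed.

Lemma natural_fun_infty a : natural_fun a = infty <-> a = 0.
Proof.
split=> [|->]; last exact: natural_fun0.
by have [//|a0] := eqVneq a 0; rewrite (natural_funE a0).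
Qed.

Lemma natural_funM a b : natural_fun (a * b) = natural_fun a + natural_fun b.
Proof.
have [->|a0] := eqVneq a 0; first by rewrite mul0r natural_fun0.
have [->|b0] := eqVneq b 0.
  by rewrite mulr0 natural_fun0 addr_infty.
rewrite (natural_funE (mulf_neq0 a0 b0)) (natural_funE a0) (natural_funE b0).
transitivity (fin (archClass_add (archCls (NonZero a0)) (archCls (NonZero b0)))).
  by rewrite archCls_mul; congr (fin (archCls _)); apply: val_inj.
by [].
Qed.

Lemma natural_funD a b :
  Num.min (natural_fun a) (natural_fun b) <= natural_fun (a + b).
Proof.
rewrite ge_min !natural_fun_le; apply/orP.
case: (leP `|a| `|b|) => [ab|/ltW ba]; [right|left]; apply/arch_leP; exists 2%N;
  by rewrite (le_trans (ler_normD _ _)) // mulr_natl mulr2n lerD.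
Qed.

Definition natural_valuation : valuation K archClass :=
  Valuation natural_fun_infty natural_funM natural_funD.

Lemma natural_valuation_lt (a b : K) :
  natural_valuation a < natural_valuation b <->
  forall n : nat, n%:R * `|b| < `|a|.
Proof.
rewrite ltNge natural_fun_le; split=> [/arch_leP ab n|ab].
  by rewrite ltNge; apply/negP => nab; apply: ab; exists n.
by apply/arch_leP => -[n]; rewrite leNgt ab.
Qed.

End ArchClass.

Section Valuations.
Variables (K : realFieldType) (G : orderedAbGroupType).
Implicit Types (w : valuation K G) (f : K -> K).

Definition valRing w : set K := [set a | fin 0 <= w a].

Definition valIdeal w : set K := [set a | fin 0 < w a].

Definition posUnits w : set K := [set a | w a = fin 0 /\ 0 < a].

Definition compatible w f : Prop :=
  f @` valRing w = posUnits w /\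
  f @` valIdeal w = [set 1 + a | a in valIdeal w].

End Valuations.

Definition coarsening (K : realFieldType) (G H : orderedAbGroupType)
    (w : valuation K G) (v : valuation K H) : Prop :=
  valRing v `<=` valRing w.

(* The values [v a] of the units [a] of the valuation ring of [w]; when [w] is a
   coarsening of [v], this is a convex subgroup of the value group of [v]. *)
Definition unitGroup (K : realFieldType) (G H : orderedAbGroupType)
    (w : valuation K G) (v : valuation K H) : set (withInfty H) :=
  v @` [set a | w a = fin 0].

Section Exponentials.
Variable K : realFieldType.
Implicit Type f : K -> K.

Definition nonarchimedean : Prop := ~ Num.archimedean_axiom K.

Definition exponential f : Prop :=
  [/\ {morph f : a b / a + b >-> a * b},
      {mono f : a b / a < b} &
      range f = [set a | 0 < a]].

Definition T1_exponential f : Prop :=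
  let v := natural_valuation K in
  [/\ exponential f,
      compatible v f &
      forall a : K, a != 0 -> valIdeal v a -> v a < v (f a - 1 - a)].

Definition strong f : Prop :=
  forall (n : nat) (a : K), (n ^ 2)%:R < a -> a ^+ n < f a.

End Exponentials.

(* Main.v *)
(* Since [R_v] is contained in [R_w], [v b <= v a] implies [w b <= w a], so
   [v a] lies in [G_w] iff [w a = 0] and the condition says that [f] maps units
   of [R_w] to units.  If it holds, [f (R_w)] consists of units because an
   infinitesimal [a] satisfies [f 1 * f a = f (1 + a)] with [1 + a] a unit; every
   positive unit is attained because [f |a| > |a|] for [|a| > 1], by strength.
   On [I_w], which is contained in [I_v], the [T_1] axiom makes [f a - 1] and [a]
   archimedean equivalent, whence [f (I_w) = 1 + I_w]. *)
Require Import Defs.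
From mathcomp Require Import all_boot all_order all_algebra.
From mathcomp Require Import boolp classical_sets.
From mathcomp Require Import lra.
Import Order.TTheory GRing.Theory Num.Theory.
Local Open Scope classical_set_scope.
Local Open Scope ring_scope.

Set Implicit Arguments.
Unset Strict Implicit.

Section Valuation.
Variables (K : realFieldType) (G : orderedAbGroupType) (w : valuation K G).

Lemma valuation1 : w 1 = fin 0.
Proof.
have := valuationM w 1 1; rewrite mulr1.
case E: (w 1) => [g|] => [[gE]|_].
  by congr Some; apply: (@addrI _ g); rewrite addr0 -gE.
by have /eqP := (valuation_infty w 1).1 E; rewrite oner_eq0.
Qed.

Lemma val_unit_neq0 a : w a = fin 0 -> a != 0.
Proof.
by move=> wa; apply/eqP => /(valuation_infty w a).2; rewrite wa.
Qed.

Lemma val_unitV a : w a = fin 0 -> w a^-1 = fin 0.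
Proof.
move=> wa; have := valuationM w a a^-1.
by rewrite divff ?val_unit_neq0 // valuation1 wa add0r.
Qed.

Lemma infty_leDr (x y : withInfty G) : fin 0 <= x -> y <= x + y.
Proof.
case: x y => [g|] [h|] //= g0; rewrite addrC.
by have := @leD2l_oag G h 0 g g0; rewrite addr0.
Qed.

End Valuation.

Section Coarsening.
Variables (K : realFieldType) (G : orderedAbGroupType) (w : valuation K G).
Let v := natural_valuation K.
Hypothesis wv : coarsening w v.

(** For nonzero [b] the quotient [a / b] lies in the valuation ring of [v], hence in that of [w],
    and [a = (a / b) * b]. *)
Lemma coarsening_le (n : nat) a b : `|a| <= n%:R * `|b| -> w b <= w a.
Proof.
move=> ab; have [b0|b0] := eqVneq b 0.
  move: ab; rewrite b0 normr0 mulr0 normr_le0 => /eqP ->.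
  exact: lexx.
rewrite -[a](divfK b0) valuationM; apply: infty_leDr.
apply: wv; rewrite /valRing /= -(valuation1 v) natural_fun_le.
apply/arch_leP; exists n.
by rewrite normr1 mulr1 normf_div ler_pdivrMr ?normr_gt0.
Qed.

Lemma coarsening_le_norm a b : `|a| <= `|b| -> w b <= w a.
Proof. by move=> ab; apply: (@coarsening_le 1); rewrite mul1r. Qed.

(** Equal natural values mean that each element is bounded by an integer multiple of the other,
    which forces equal [w]-values. *)
Lemma unitGroup_coarsening a : unitGroup w v (v a) <-> w a = fin 0.
Proof.
split=> [[u wu uaE]|wa]; last by exists a.
have {}uaE : natural_fun u = natural_fun a := uaE.
have /arch_leP[n ua] : arch_le u a by rewrite -natural_fun_le uaE.
have /arch_leP[m au] : arch_le a u by rewrite -natural_fun_le uaE.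
by apply/le_anti; rewrite -wu (coarsening_le ua) (coarsening_le au).
Qed.

(** If [a] were not infinitesimal, [1] would be bounded by a multiple of [a], so that
    [w a <= w 1 = 0]. *)
Lemma valIdeal_coarsening : valIdeal w `<=` valIdeal v.
Proof.
move=> a wa; rewrite /valIdeal /= -(valuation1 v) ltNge natural_fun_le.
apply/negP => /arch_leP[n /coarsening_le].
by rewrite valuation1 leNgt wa.
Qed.

Lemma val_1D a : valIdeal w a -> w (1 + a) = fin 0.
Proof.
move=> wa; apply/le_anti/andP; split; last first.
  apply: le_trans (valuationD w 1 a).
  by rewrite valuation1 le_min lexx ltW.
(* Writing [1 = (1 + a) - a], one summand has value at most [0], and it cannot be [- a]. *)
have := valuationD w (1 + a) (- a); rewrite addrK valuation1 ge_min.
case/orP => // Na0; have : w a <= w (- a).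
  by apply: coarsening_le_norm; rewrite normrN.
by move/le_trans => /(_ _ Na0); rewrite leNgt wa.
Qed.

End Coarsening.

Section T1Exponential.
Variables (K : realFieldType) (f : K -> K).
Hypothesis T1f : T1_exponential f.
Let v := natural_valuation K.

Lemma exponential_gt0 a : 0 < f a.
Proof.
by case: T1f => -[_ _ rf] _ _; have : range f (f a) by []; rewrite rf.
Qed.

Lemma exponential0 : f 0 = 1.
Proof.
case: T1f => -[fD _ _] _ _; apply: (mulfI (lt0r_neq0 (exponential_gt0 0))).
by rewrite -fD addr0 mulr1.
Qed.

Lemma exponentialN a : f (- a) = (f a)^-1.
Proof.
case: T1f => -[fD _ _] _ _; apply: (mulfI (lt0r_neq0 (exponential_gt0 a))).
by rewrite -fD subrr exponential0 divff ?lt0r_neq0 ?exponential_gt0.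
Qed.

Lemma T1_exponential_bounds a : valIdeal v a ->
  `|f a - 1| <= 2%:R * `|a| /\ `|a| <= 2%:R * `|f a - 1|.
Proof.
move=> va; have [->|a0] := eqVneq a 0.
  by rewrite exponential0 subrr normr0 mulr0.
(* The multiple 2 of the remainder [f a - 1 - a] suffices: it is then smaller than half of [a] in
   absolute value. *)
case: T1f => _ _ /(_ a a0 va) /natural_valuation_lt /(_ 2).
set d := `|_ - a| => da.
have h1 : `|f a - 1| <= d + `|a| by rewrite -{1}[f a - 1](subrK a) ler_normD.
have h2 : `|a| <= `|f a - 1| + d.
  by rewrite -{1}[a](subKr (f a - 1)); apply: ler_normB.
have d0 : 0 <= d by apply: normr_ge0.
by split; lra.
Qed.

Lemma T1_exponential_valIdeal (G : orderedAbGroupType) (w : valuation K G) :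
  coarsening w v -> f @` valIdeal w = [set 1 + a | a in valIdeal w].
Proof.
move=> wv; apply/seteqP; split=> [_ [a wa <-]|_ [b wb <-]].
  have [h _] := T1_exponential_bounds (valIdeal_coarsening wv wa).
  exists (f a - 1); last by rewrite addrC subrK.
  exact: lt_le_trans wa (coarsening_le wv h).
(* Compatibility of [v] gives an infinitesimal preimage; the second bound then moves it into the
   ideal of [w]. *)
have : (f @` valIdeal v) (1 + b).
  case: T1f => _ [_ ->] _.
  by exists b => //; apply: valIdeal_coarsening wb.
case=> a va fa; exists a => //.
have [_] := T1_exponential_bounds va.
rewrite fa addrAC subrr add0r => /(coarsening_le wv).
exact: lt_le_trans wb.
Qed.

Lemma strong_exponential_valRing (G : orderedAbGroupType) (w : valuation K G) a :
  strong f -> coarsening w v -> w (f a) = fin 0 -> valRing w a.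
Proof.
move=> sf wv wfa; rewrite /valRing /=.
(* Since [f (- a)] is the inverse of [f a], the sign of [a] does not matter. *)
have wf : w (f `|a|) = fin 0.
  by case: ger0P => // _; rewrite exponentialN; apply: val_unitV.
have [a1|a1] := leP `|a| 1.
  by rewrite -(valuation1 w); apply: coarsening_le_norm; rewrite ?normr1.
(* Strength with exponent 1, whose threshold is [1 ^ 2 = 1]. *)
have : `|a| ^+ 1 < f `|a| by apply: sf.
rewrite expr1 => /ltW fa; rewrite -wf; apply: coarsening_le_norm => //.
by rewrite (gtr0_norm (exponential_gt0 _)).
Qed.

End T1Exponential.

Unset Implicit Arguments.
Set Strict Implicit.

Theorem theorem1 (K : realFieldType) (f : K -> K)
    (G : orderedAbGroupType) (w : valuation K G) :
  let v := natural_valuation K in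
  nonarchimedean K ->
  T1_exponential f ->
  strong f ->
  coarsening w v ->
  compatible w f <->
  (forall a : K, unitGroup w v (v a) -> unitGroup w v (v (f a))).
Proof.
move=> v _ T1f sf wv; split=> [[fR _] a|fU].
  move=> /(unitGroup_coarsening wv) wa; apply/(unitGroup_coarsening wv).
  have : (f @` valRing w) (f a) by exists a => //; rewrite /valRing /= wa.
  by rewrite fR => -[].
have {}fU a : w a = fin 0 -> w (f a) = fin 0.
  move=> wa; apply/(unitGroup_coarsening wv)/fU.
  exact/(unitGroup_coarsening wv).
split; last exact: T1_exponential_valIdeal.
apply/seteqP; split=> [_ [a wa <-]|b [wb b0]].
  split; last exact: exponential_gt0.
  move: wa; rewrite /valRing /= le_eqVlt => /orP[/eqP/esym/fU //|wa].
  have := fU _ (val_1D wv wa); case: (T1f) => -[fD _ _] _ _.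
  by rewrite fD valuationM (fU 1) ?valuation1 // add0r.
case: (T1f) => -[_ _ rf] _ _.
(* Surjectivity only gives some preimage in [K]; the growth of [f] places it in the valuation ring
   of [w]. *)
have [a _ fa] : range f b by rewrite rf.
by exists a => //; apply: (strong_exponential_valRing T1f sf wv); rewrite fa.
Qed.
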